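(* Let $\Theta\sim G$ be a real random variable (a distribution of true effects), $p_0=P(\Theta=0)$, $\Delta>0$ fixed and $\alpha\in(0,1)$. For each $n$ let $q_n:\mathbb R\to[0,1]$ be measurable and let $S_n$ be an event with $P(S_n\mid\Theta)=q_n(\Theta)$. Assume $$q_n(\theta)\to1\quad\text{for every fixed }\theta\ne0,\qquad q_n(0)\to\alpha,$$ and let $IDS_n=P(|\Theta|<\Delta\mid S_n)$. Then $$IDS_n\longrightarrow\frac{P(0<|\Theta|<\Delta)+\alpha p_0}{1-p_0+\alpha p_0}.$$ If $G$ is continuous, then $p_0=0$ and $$IDS_n\longrightarrow P(|\Theta|<\Delta).$$
   Context: $S_n$ represents the event that a point-null test of $H_0:\Theta=0$ rejects (''statistical significance''), $q_n(\theta)$ its conditional rejection probability given $\Theta=\theta$, and $\alpha$ its limiting level. $IDS_n$ is called the irrelevant discovery share; it is defined whenever $P(S_n)>0$, which holds for all large $n$. ''$G$ continuous'' means that $G$ has no atoms. *)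

(* Defs.v *)
From HB Require Import structures.
From mathcomp Require Import all_boot all_order all_algebra.
From mathcomp Require Import all_classical all_reals all_analysis.

Set Implicit Arguments.
Unset Strict Implicit.
Unset Printing Implicit Defensive.

Import Order.TTheory GRing.Theory Num.Theory.
Import numFieldNormedType.Exports.

Local Open Scope classical_set_scope.
Local Open Scope ring_scope.

Definition Prob (d : measure_display) (T : measurableType d) (R : realType)
    (P : probability T R) (A : set T) : R := fine (P A).

(* Elementary conditional probability P(A | B). It is meaningful only when
   0 < P B; otherwise its value is the junk value 0. *)
Definition cond_Prob (d : measure_display) (T : measurableType d)
    (R : realType) (P : probability T R) (A B : set T) : R :=
  Prob P (A `&` B) / Prob P B.

(* P(S | X) = q(X): for measurable q, the random variable q(X) is a version of
   the conditional probability of S given the sigma-algebra generated by X,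
   whose elements are the sets X @^-1` B with B Borel. *)
Definition is_cond_Prob_given (d : measure_display) (T : measurableType d)
    (R : realType) (P : probability T R) (X : {RV P >-> R}) (S : set T)
    (q : R -> R) : Prop :=
  forall B : set R, measurable B ->
    P (S `&` X @^-1` B) = (\int[P]_(w in X @^-1` B) (q (X w))%:E)%E.

Definition has_law (d : measure_display) (T : measurableType d)
    (R : realType) (P : probability T R) (X : {RV P >-> R})
    (G : probability R R) : Prop :=
  forall B : set R, measurable B -> distribution P X B = G B.

Definition atomless (R : realType) (G : probability R R) : Prop :=
  forall x : R, G [set x] = 0%E.

(* The irrelevant discovery share P(|Theta| < Delta | S). *)
Definition IDS (d : measure_display) (T : measurableType d) (R : realType)
    (P : probability T R) (Theta : {RV P >-> R}) (Delta : R) (S : set T) : R :=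
  cond_Prob P [set w | `|Theta w| < Delta] S.

(* Main.v *)
(* Split the event {Theta \in B} at the atom {Theta = 0}. On Theta = 0 the
   rejection probability is exactly q_n(0) p_0; off it, q_n(Theta) -> 1
   pointwise and boundedly, so dominated convergence applies. Taking B to be
   the whole line and ]-Delta, Delta[ gives the denominator and numerator. *)

Require Import Defs.
From HB Require Import structures.
From mathcomp Require Import all_boot all_order all_algebra.
From mathcomp Require Import all_classical all_reals all_analysis.
From mathcomp Require Import measurable_realfun lra.

Set Implicit Arguments.
Unset Strict Implicit.
Unset Printing Implicit Defensive.

Import Order.TTheory GRing.Theory Num.Theory.
Import numFieldNormedType.Exports.

Local Open Scope classical_set_scope.
Local Open Scope ring_scope.

Lemma ProbU (d : measure_display) (T : measurableType d) (R : realType)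
    (P : probability T R) (A B : set T) :
  measurable A -> measurable B -> A `&` B = set0 ->
  Prob P (A `|` B) = Prob P A + Prob P B.
Proof.
by move=> mA mB AB0; rewrite /Prob measureU // fineD // fin_num_measure.
Qed.

Lemma Prob_setC (d : measure_display) (T : measurableType d) (R : realType)
    (P : probability T R) (A : set T) :
  measurable A -> Prob P (~` A) = 1 - Prob P A.
Proof.
by move=> mA; rewrite /Prob probability_setC // fineB // fin_num_measure.
Qed.

Section RejectionLimit.
Context (R : realType) (d : measure_display) (T : measurableType d).
Variables (P : probability T R) (Theta : {RV P >-> R}).

Lemma Prob_cond_atom (S : set T) (q : R -> R) (x : R) :
  is_cond_Prob_given Theta S q ->
  Prob P (S `&` Theta @^-1` [set x]) = q x * Prob P (Theta @^-1` [set x]).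
Proof.
move=> S_cond; rewrite /Prob S_cond //.
have mx : measurable (Theta @^-1` [set x]) by exact: measurable_funPTI.
rewrite (eq_integral (cst (q x)%:E)); last first.
  by move=> w; rewrite inE /= => ->.
by rewrite integral_cst // fineM // fin_num_measure.
Qed.

Variables (q : nat -> R -> R) (S : nat -> set T).
Hypothesis q_meas : forall n, measurable_fun [set: R] (q n).
Hypothesis q_range : forall n theta, 0 <= q n theta <= 1.
Hypothesis S_meas : forall n, measurable (S n).
Hypothesis S_cond : forall n, is_cond_Prob_given Theta (S n) (q n).

Lemma cvg_Prob_cond (B : set R) : measurable B ->
  (forall theta, B theta -> q n theta @[n --> \oo] --> (1 : R)) ->
  Prob P (S n `&` Theta @^-1` B) @[n --> \oo] --> Prob P (Theta @^-1` B).
Proof.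
move=> mB q_alt.
have mD : measurable (Theta @^-1` B) by exact: measurable_funPTI.
apply: fine_cvg; rewrite fineK ?fin_num_measure//.
under eq_cvg do rewrite S_cond //.
rewrite -[P (Theta @^-1` B)]mul1e -(integral_cst P mD 1%E).
apply: (@dominated_cvg _ _ _ P _ mD _ _ (EFin \o cst 1)) => //.
- move=> n; apply/measurable_EFinP; apply: measurable_funTS.
  exact: measurableT_comp.
- move=> w Bw /=; apply: cvg_EFin; first exact: nearW.
  exact: q_alt.
- exact: finite_measure_integrable_cst.
- move=> n w _ /=; have /andP[q0 q1] := q_range n (Theta w).
  by rewrite lee_fin ger0_norm.
Qed.

Lemma cvg_Prob_cond_null (alpha : R) (B : set R) : measurable B -> B 0 ->
  (forall theta, theta != 0 -> q n theta @[n --> \oo] --> (1 : R)) ->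
  q n 0 @[n --> \oo] --> alpha ->
  Prob P (S n `&` Theta @^-1` B) @[n --> \oo] -->
    Prob P (Theta @^-1` (B `\ 0)) + alpha * Prob P (Theta @^-1` [set 0]).
Proof.
move=> mB B0 q_alt q_null.
have mB0 : measurable (B `\ 0) by exact: measurableD.
rewrite (_ : (fun n => Prob P (S n `&` Theta @^-1` B)) = (fun n =>
    Prob P (S n `&` Theta @^-1` (B `\ 0)) +
    q n 0 * Prob P (Theta @^-1` [set 0]))).
  apply: cvgD; last exact: cvgMr_tmp.
  by apply: cvg_Prob_cond => // theta [_ /eqP]; exact: q_alt.
apply/funext => n; rewrite -(Prob_cond_atom 0 (S_cond n)) -ProbU.
- by rewrite -setIUr -preimage_setU setUC setDUK // => _ ->.
- by apply: measurableI => //; exact: measurable_funPTI.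
- by apply: measurableI => //; exact: measurable_funPTI.
- by apply/seteqP; split => // w [[_ [_ w0]] [_ /w0]].
Qed.

End RejectionLimit.

Theorem theorem2 (R : realType) (d : measure_display) (T : measurableType d)
    (P : probability T R) (Theta : {RV P >-> R}) (G : probability R R)
    (hG : has_law Theta G)
    (Delta : R) (hDelta : 0 < Delta)
    (alpha : R) (halpha0 : 0 < alpha) (halpha1 : alpha < 1)
    (q : nat -> R -> R)
    (q_meas : forall n, measurable_fun [set: R] (q n))
    (q_range : forall n theta, 0 <= q n theta <= 1)
    (S : nat -> set T)
    (S_meas : forall n, measurable (S n))
    (S_cond : forall n, is_cond_Prob_given Theta (S n) (q n))
    (q_alt : forall theta : R, theta != 0 -> q n theta @[n --> \oo] --> (1 : R))
    (q_null : q n 0 @[n --> \oo] --> alpha) :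
  let p0 := Prob P [set w | Theta w = 0] in
  [/\ \forall n \near \oo, 0 < Prob P (S n),
      IDS Theta Delta (S n) @[n --> \oo] -->
        (Prob P [set w | 0 < `|Theta w| < Delta] + alpha * p0)
          / (1 - p0 + alpha * p0)
    & atomless G ->
        p0 = 0 /\
        IDS Theta Delta (S n) @[n --> \oo] -->
          Prob P [set w | `|Theta w| < Delta]].
Proof.
move=> p0.
have mpre (B : set R) : measurable B -> measurable (Theta @^-1` B).
  by move=> mB; exact: measurable_funPTI.
have mDelta : measurable [set x : R | `|x| < Delta].
  rewrite (_ : [set _ | _] = `]-Delta, Delta[%classic) //.
  by apply/seteqP; split => x /=; rewrite in_itv /= ltr_norml.
have ball_minus0 :
    Theta @^-1` ([set x | `|x| < Delta] `\ 0) =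
    [set w | 0 < `|Theta w| < Delta].
  apply/seteqP; split => w /=.
    by move=> [wD /eqP w0]; rewrite normr_gt0 w0.
  by rewrite normr_gt0 => /andP[/eqP].
have cvgS : Prob P (S n) @[n --> \oo] --> 1 - p0 + alpha * p0.
  have := cvg_Prob_cond_null q_meas q_range S_meas S_cond
    measurableT I q_alt q_null.
  rewrite setTD -preimage_setC Prob_setC; last exact: mpre.
  by rewrite preimage_setT; under eq_cvg do rewrite setIT.
have cvgN : Prob P ([set w | `|Theta w| < Delta] `&` S n) @[n --> \oo] -->
    Prob P [set w | 0 < `|Theta w| < Delta] + alpha * p0.
  rewrite -ball_minus0; under eq_cvg do rewrite setIC.
  by apply: cvg_Prob_cond_null => //=; rewrite normr0.
have p0_le1 : p0 <= 1.
  have m0 := mpre [set 0] (measurable_set1 _).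
  by rewrite -lee_fin fineK ?fin_num_measure ?probability_le1.
have lim_gt0 : 0 < 1 - p0 + alpha * p0 by nra.
have cvgIDS : IDS Theta Delta (S n) @[n --> \oo] -->
    (Prob P [set w | 0 < `|Theta w| < Delta] + alpha * p0)
      / (1 - p0 + alpha * p0).
  by apply: cvgM => //; apply: cvgV => //; rewrite gt_eqF.
split => //; first exact: (cvgr_gt _ cvgS).
move=> G_atomless.
have p00 : p0 = 0.
  by rewrite /p0 /Prob -[P _]/(distribution P Theta [set 0]) hG // G_atomless.
split => //; move: cvgIDS; rewrite p00 mulr0 subr0 !addr0 divr1.
suff -> : Prob P [set w | `|Theta w| < Delta] =
    Prob P [set w | 0 < `|Theta w| < Delta] by [].
rewrite -[RHS]addr0 -[X in _ = _ + X]p00 -ball_minus0 -ProbU.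
- rewrite -[X in _ `|` X]/(Theta @^-1` [set 0]) -preimage_setU setUC setDUK //.
  by move=> _ -> /=; rewrite normr0.
- by apply: mpre; exact: measurableD.
- exact: (mpre [set 0]).
- by apply/seteqP; split => // w /= [[_ w0] /w0].
Qed.
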